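(* Let $\kappa>0$ be a constant. Let $\mathcal{A}$ be a set of propositional atoms (attributes) containing pairwise distinct atoms $a,b,c,d,x,y,z_{ab},z_{ac},z_{ad},z_{bc},z_{bd},z_{cd}$, and let $$\begin{aligned}K=\{& a\wedge b\rightarrow x,\; c\wedge d\rightarrow x,\; a\wedge c\rightarrow y,\; b\wedge d\rightarrow y,\; a\wedge d\rightarrow y,\; b\wedge c\rightarrow y,\\ & a\rightarrow z_{ab},\; b\rightarrow z_{ab},\; a\rightarrow z_{ac},\; c\rightarrow z_{ac},\; a\rightarrow z_{ad},\; d\rightarrow z_{ad},\\ & b\rightarrow z_{bc},\; c\rightarrow z_{bc},\; b\rightarrow z_{bd},\; d\rightarrow z_{bd},\; c\rightarrow z_{cd},\; d\rightarrow z_{cd}\}.\end{aligned}$$ Then $K$ cannot be simulated by the embedding strategy $(\phi_{\mathrm{sig}},\psi_{\mathrm{dot}})$. That is, there do not exist an integer $m\geq 1$, vectors $\mathbf{p},\tilde{\mathbf{p}}\in\mathbb{R}^m$ and thresholds $\lambda_p\in\mathbb{R}$ (for $p\in\mathcal{A}$) such that for every $q\in\mathcal{A}$ and every finite (possibly empty) set $\{p_1,\dots,p_n\}\subseteq\mathcal{A}$ of $n$ distinct attributes: $$q\in \mathrm{Lab}_{\mathrm{dot}}(\mathrm{Emb}_{\mathrm{sig}}(p_1,\dots,p_n)) \iff K\models p_1\wedge\dots\wedge p_n\rightarrow q .$$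
   Context: Each attribute $p\in\mathcal{A}$ is assigned two vectors $\mathbf{p},\tilde{\mathbf{p}}\in\mathbb{R}^m$ (possibly different) and a threshold $\lambda_p\in\mathbb{R}$; the dimension $m$ may be chosen arbitrarily. With $\sigma(t)=1/(1+e^{-t})$ the sigmoid function, the embedding function is $\mathrm{Emb}_{\mathrm{sig}}(p_1,\dots,p_n)=\arg\max_{\mathbf{e}\in\mathbb{R}^m}\left(\sum_{i=1}^n\log\sigma(\mathbf{e}\cdot\mathbf{p}_i)-\kappa\|\mathbf{e}\|^2\right)$ (for $n=0$ the sum is empty). The labelling function is $\mathrm{Lab}_{\mathrm{dot}}(\mathbf{e})=\{q\in\mathcal{A} \mid \mathbf{e}\cdot\tilde{\mathbf{q}}\geq\lambda_q\}$ for $\mathbf{e}\in\mathbb{R}^m$. The symbol $\models$ denotes standard propositional entailment over the atoms $\mathcal{A}$; the empty conjunction is $\top$. *)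

(* Defs.v *)
From HB Require Import structures.
From mathcomp Require Import all_boot all_order all_algebra.
From mathcomp Require Import all_classical all_reals all_analysis.

Set Implicit Arguments.
Unset Strict Implicit.
Unset Printing Implicit Defensive.

Import Order.TTheory GRing.Theory Num.Theory.

Local Open Scope classical_set_scope.
Local Open Scope ring_scope.

Inductive form (A : Type) : Type :=
| Top
| Atom of A
| And of form A & form A
| Imp of form A & form A.

Arguments Top {A}.

Fixpoint holds (A : Type) (v : A -> bool) (f : form A) : bool :=
  match f with
  | Top => true
  | Atom p => v p
  | And g h => holds v g && holds v h
  | Imp g h => holds v g ==> holds v h
  end.

Definition entails (A : Type) (K : seq (form A)) (f : form A) : Prop :=
  forall v : A -> bool, all (holds v) K -> holds v f.

Definition big_And (A : Type) (s : seq A) : form A :=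
  if s is p :: s' then foldl (fun f r => And f (Atom r)) (Atom p) s' else Top.

Definition rule (A : Type) (s : seq A) (q : A) : form A := Imp (big_And s) (Atom q).

Definition sigmoid (R : realType) (t : R) : R := 1 / (1 + expR (- t)).

(* The library norm on 'rV[R]_m is the max norm, so the squared Euclidean norm
   of e is written dotv e e below. *)
Definition dotv (R : realType) (m : nat) (u v : 'rV[R]_m) : R :=
  \sum_(i < m) u 0 i * v 0 i.

Definition argmax (R : realType) (T : Type) (f : T -> R) : set T :=
  [set e | forall e', f e' <= f e].

Definition objective (R : realType) (A : Type) (m : nat) (kappa : R)
    (vec : A -> 'rV[R]_m) (s : seq A) (e : 'rV[R]_m) : R :=
  \sum_(p <- s) ln (sigmoid (dotv e (vec p))) - kappa * dotv e e.

(* For kappa > 0 the objective is continuous, strictly concave and coercive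
   (each log-sigmoid term is concave and negative), so the maximiser exists and
   is unique and the default value 0 of xget is not used. *)
Definition Emb_sig (R : realType) (A : Type) (m : nat) (kappa : R)
    (vec : A -> 'rV[R]_m) (s : seq A) : 'rV[R]_m :=
  xget 0 (argmax (objective kappa vec s)).

Definition Lab_dot (R : realType) (A : Type) (m : nat)
    (tvec : A -> 'rV[R]_m) (lambda : A -> R) (e : 'rV[R]_m) : set A :=
  [set q | dotv e (tvec q) >= lambda q].

(* Main.v *)
(** The sigmoid embedding of a set of attributes lies in the cone they generate:
    if every attribute vector has non-positive product with [h], then moving the
    maximiser along [-h] cannot decrease any log-sigmoid term, so the
    regularisation forces it to have non-positive product with [h] as well.
    Applied to the empty set, this makes all thresholds positive.  Then
    [h := lambda_y x~ - lambda_x y~] is positive on the embeddings of [ab] and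
    [cd] and negative on those of the four cross pairs.  By the cone property
    [h] is positive on [a] or [b], hence negative on both [c] and [d], hence
    non-positive on the embedding of [cd]: a contradiction. *)

Require Import Defs.
From mathcomp Require Import all_boot all_order all_algebra.
From mathcomp Require Import all_classical all_reals all_analysis.
From mathcomp Require Import ring lra.

Import Order.TTheory GRing.Theory Num.Theory.

Local Open Scope ring_scope.

Section Dot.
Set Implicit Arguments.
Unset Strict Implicit.
Variables (R : realType) (m : nat).
Implicit Types u v w : 'rV[R]_m.

Lemma dotvC u v : dotv u v = dotv v u.
Proof. by apply: eq_bigr => i _; rewrite mulrC. Qed.

Lemma dotvBr u v w : dotv u (v - w) = dotv u v - dotv u w.
Proof. by rewrite /dotv -sumrB; apply: eq_bigr => i _; rewrite !mxE mulrBr. Qed.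

Lemma dotvZr (k : R) u v : dotv u (k *: v) = k * dotv u v.
Proof. by rewrite /dotv mulr_sumr; apply: eq_bigr => i _; rewrite !mxE mulrCA. Qed.

Lemma dotvBl u v w : dotv (u - v) w = dotv u w - dotv v w.
Proof. by rewrite !(dotvC _ w) dotvBr. Qed.

Lemma dotvZl (k : R) u v : dotv (k *: u) v = k * dotv u v.
Proof. by rewrite !(dotvC _ v) dotvZr. Qed.

Lemma dotv0l u : dotv 0 u = 0.
Proof. by rewrite -(scale0r 0) dotvZl mul0r. Qed.

Lemma dotv_ge0 u : 0 <= dotv u u.
Proof. by apply: sumr_ge0 => i _; rewrite -expr2 sqr_ge0. Qed.

End Dot.

Lemma le_ln_sigmoid (R : realType) (s t : R) :
  s <= t -> ln (sigmoid s) <= ln (sigmoid t).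
Proof.
have den_gt0 r : 0 < 1 + expR (- r) :> R by rewrite addr_gt0 ?expR_gt0.
move=> le_st; rewrite /sigmoid !div1r ler_ln ?posrE ?invr_gt0 //.
by rewrite lef_pV2 ?posrE // lerD2l ler_expR lerN2.
Qed.

Section Embedding.
Set Implicit Arguments.
Unset Strict Implicit.
Variables (R : realType) (A : eqType) (m : nat) (kappa : R).
Variable vec : A -> 'rV[R]_m.
Hypothesis kappa_gt0 : 0 < kappa.
Implicit Types (s : seq A) (h : 'rV[R]_m).

(* No existence of a maximiser is needed: without one, [Emb_sig] is [0]. *)
Lemma dotv_Emb_sig_le0 s h : {in s, forall p, dotv (vec p) h <= 0} ->
  dotv (Emb_sig kappa vec s) h <= 0.
Proof.
rewrite /Emb_sig => h_le0; case: xgetP => [e _ e_max|_]; last by rewrite dotv0l.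
rewrite leNgt; apply/negP => eh_gt0.
have hh_ge0 := dotv_ge0 h.
(* With this step, [e - t *: h] has squared norm smaller than that of [e] by
   [t ^ 2 * (dotv h h + 2)]. The [+ 1] keeps the denominator positive without a separate argument
   that [h] is nonzero. *)
pose t := dotv e h / (dotv h h + 1).
have den_gt0 : 0 < dotv h h + 1 by rewrite ltr_wpDl.
have t_gt0 : 0 < t by rewrite divr_gt0.
have tE : t * (dotv h h + 1) = dotv e h by rewrite divfK ?gt_eqF.
have shrink : dotv (e - t *: h) (e - t *: h) < dotv e e.
  rewrite !dotvBl !dotvBr !dotvZl !dotvZr (dotvC h e) -tE; nra.
have := e_max (e - t *: h); apply/negP; rewrite -ltNge /objective.
apply: ler_ltD; last by rewrite ltrN2 ltr_pM2l.
rewrite !big_seq; apply: ler_sum => p ps; apply: le_ln_sigmoid.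
by rewrite dotvBl dotvZl (dotvC h) lerBrDr gerDl pmulr_rle0 ?h_le0.
Qed.

Lemma dotv_Emb_sig_ge0 s h : {in s, forall p, 0 <= dotv (vec p) h} ->
  0 <= dotv (Emb_sig kappa vec s) h.
Proof.
move=> h_ge0; rewrite -oppr_le0 -mulN1r -dotvZr dotv_Emb_sig_le0 // => p ps.
by rewrite dotvZr mulN1r oppr_le0 h_ge0.
Qed.

(** Over the empty list both sign hypotheses of the cone property hold vacuously. *)
Lemma dotv_Emb_sig_nil h : dotv (Emb_sig kappa vec [::]) h = 0.
Proof.
by apply/eqP; rewrite eq_le dotv_Emb_sig_le0 ?dotv_Emb_sig_ge0.
Qed.

Lemma dotv_Emb_sig2_gt0 (p q : A) h : 0 < dotv (Emb_sig kappa vec [:: p; q]) h ->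
  0 < dotv (vec p) h \/ 0 < dotv (vec q) h.
Proof.
move=> pq_gt0; apply/orP; apply: contraLR pq_gt0.
rewrite negb_or -!leNgt => /andP[p_le0 q_le0]; apply: dotv_Emb_sig_le0 => r.
by rewrite !inE => /orP[] /eqP->.
Qed.

Lemma dotv_Emb_sig2_lt0 (p q : A) h : dotv (Emb_sig kappa vec [:: p; q]) h < 0 ->
  0 < dotv (vec p) h -> dotv (vec q) h < 0.
Proof.
move=> pq_lt0 p_gt0; apply: contraLR pq_lt0; rewrite -!leNgt => q_ge0.
apply: dotv_Emb_sig_ge0 => r; rewrite !inE => /orP[] /eqP-> //; exact: ltW.
Qed.

Lemma Emb_sig_pairs (a b c d : A) h :
  0 < dotv (Emb_sig kappa vec [:: a; b]) h ->
  0 < dotv (Emb_sig kappa vec [:: c; d]) h ->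
  {in [:: a; b] & [:: c; d], forall p q, dotv (Emb_sig kappa vec [:: p; q]) h < 0} ->
  False.
Proof.
move=> ab_gt0 cd_gt0 cross_lt0.
have [p p_ab p_gt0] : exists2 p, p \in [:: a; b] & 0 < dotv (vec p) h.
  by case: (dotv_Emb_sig2_gt0 ab_gt0); [exists a|exists b]; rewrite ?inE ?eqxx ?orbT.
(* The same [p] is paired with [c] and with [d]: a cross pair has a negative embedding, so its two
   vectors cannot both have non-negative product with [h]. *)
have q_lt0 q : q \in [:: c; d] -> dotv (vec q) h < 0.
  by move=> q_cd; apply: dotv_Emb_sig2_lt0 p_gt0; apply: cross_lt0.
by have := cd_gt0; rewrite ltNge dotv_Emb_sig_le0 // => q /q_lt0 /ltW.
Qed.

End Embedding.

(** Supplies countermodels: distinct atoms have distinct indices, so looking up the truth value by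
    index is consistent. *)
Lemma uniq_valuation (A : eqType) (s : seq A) (bs : seq bool) :
  uniq s -> size s = size bs -> exists v : A -> bool, map v s = bs.
Proof.
move=> s_uniq s_bs; exists (fun p => nth true bs (index p s)).
case: s s_uniq s_bs => [|p0 s] s_uniq s_bs; first by case: bs s_bs.
apply: (@eq_from_nth _ true) => [|i]; first by rewrite size_map.
by rewrite size_map => i_s; rewrite (nth_map p0) // index_uniq.
Qed.
Arguments uniq_valuation {A s}.

Theorem mainTheorem5 (R : realType) (kappa : R) (hkappa : 0 < kappa)
    (A : eqType) (a b c d x y zab zac zad zbc zbd zcd : A)
    (hdistinct : uniq [:: a; b; c; d; x; y; zab; zac; zad; zbc; zbd; zcd]) :
  let K := [:: rule [:: a; b] x; rule [:: c; d] x;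
               rule [:: a; c] y; rule [:: b; d] y;
               rule [:: a; d] y; rule [:: b; c] y;
               rule [:: a] zab; rule [:: b] zab;
               rule [:: a] zac; rule [:: c] zac;
               rule [:: a] zad; rule [:: d] zad;
               rule [:: b] zbc; rule [:: c] zbc;
               rule [:: b] zbd; rule [:: d] zbd;
               rule [:: c] zcd; rule [:: d] zcd] in
  ~ exists (m : nat) (vec tvec : A -> 'rV[R]_m) (lambda : A -> R),
      (1 <= m)%N /\
      forall (q : A) (s : seq A), uniq s ->
        (Lab_dot tvec lambda (Emb_sig kappa vec s) q <-> entails K (rule s q)).
Proof.
move=> K [m [vec [tvec [lambda [_ labP]]]]].
pose emb := Emb_sig kappa vec.
have lab_ge q s : uniq s -> entails K (rule s q) -> lambda q <= dotv (emb s) (tvec q).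
  by move=> s_uniq /(labP q s s_uniq).
have lab_lt q s : uniq s -> ~ entails K (rule s q) -> dotv (emb s) (tvec q) < lambda q.
  by move=> s_uniq nKq; rewrite ltNge; apply/negP => /(labP q s s_uniq).
(* Criterion for non-entailment: all [z] atoms are made true, which satisfies their rules. The first
   two premises encode the rules for [x] and [y]; the four rules for [y] merge into one
   implication. *)
have nent va vb vc vd vx vy q s :
    (va && vb || vc && vd ==> vx) -> ((va || vb) && (vc || vd) ==> vy) ->
    (forall v, v a = va -> v b = vb -> v c = vc -> v d = vd ->
       v x = vx -> v y = vy -> ~~ holds v (rule s q)) ->
    ~ entails K (rule s q).
  move=> x_ok y_ok falsifies Kq.
  have [v [va_ vb_ vc_ vd_ vx_ vy_ E1 E2 E3 E4 E5 E6]] := uniq_valuation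
    ([:: va; vb; vc; vd; vx; vy] ++ nseq 6 true) hdistinct erefl.
  have := falsifies v va_ vb_ vc_ vd_ vx_ vy_; rewrite Kq // /K /=.
  rewrite va_ vb_ vc_ vd_ vx_ vy_ E1 E2 E3 E4 E5 E6.
  by move: x_ok y_ok {falsifies va_ vb_ vc_ vd_ vx_ vy_}; case: va; case: vb;
     case: vc; case: vd; case: vx; case: vy.
(* The empty set does not entail [x], and its embedding has product [0] with every vector. *)
have lx_gt0 : 0 < lambda x.
  rewrite -(dotv_Emb_sig_nil vec hkappa (tvec x)) lab_lt //.
  by apply: (nent false false false false false true) => // v _ _ _ _ Ex _; rewrite /= Ex.
have ly_gt0 : 0 < lambda y.
  rewrite -(dotv_Emb_sig_nil vec hkappa (tvec y)) lab_lt //.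
  by apply: (nent false false false false true false) => // v _ _ _ _ _ Ey; rewrite /= Ey.
(* The weights cancel the thresholds: scores [lambda x] and [lambda y] together give value [0]. As
   both weights are positive, reaching one threshold and missing the other fixes the sign. *)
pose h := lambda y *: tvec x - lambda x *: tvec y.
have hE s : dotv (emb s) h =
    lambda y * dotv (emb s) (tvec x) - lambda x * dotv (emb s) (tvec y).
  by rewrite dotvBr !dotvZr.
have h_gt0 s : uniq s -> entails K (rule s x) -> ~ entails K (rule s y) ->
    0 < dotv (emb s) h.
  move=> s_uniq /(lab_ge _ _ s_uniq) sx /(lab_lt _ _ s_uniq) sy.
  rewrite hE; nra.
have h_lt0 s : uniq s -> ~ entails K (rule s x) -> entails K (rule s y) ->
    dotv (emb s) h < 0.
  move=> s_uniq /(lab_lt _ _ s_uniq) sx /(lab_ge _ _ s_uniq) sy.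
  rewrite hE; nra.
have pair_uniq p q : p != q -> uniq [:: p; q] by rewrite /= inE => ->.
move: (hdistinct); rewrite /= !inE !negb_or.
case/and5P => /and5P[ab ac ad _ _] /and4P[bc bd _ _] /andP[cd _] _ _.
apply: (@Emb_sig_pairs _ _ _ _ vec hkappa a b c d h).
- apply: h_gt0; first exact: pair_uniq.
    by move=> v /= /andP[].
  by apply: (nent true true false false true false) => // v Ea Eb _ _ _ Ey; rewrite /= Ea Eb Ey.
- apply: h_gt0; first exact: pair_uniq.
    by move=> v /= /and3P[].
  by apply: (nent false false true true true false) => // v _ _ Ec Ed _ Ey; rewrite /= Ec Ed Ey.
(* Each cross pair is the body of a rule for [y]. What remains is that [x] does not follow: making
   only that pair true among [a], [b], [c], [d] triggers no rule for [x]. *)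
move=> p q; rewrite !inE => /orP[] /eqP-> /orP[] /eqP->; apply: h_lt0;
  try exact: pair_uniq; try by move=> v; rewrite /K /=; do ![case/andP => ?].
- by apply: (nent true false true false false true) => // v Ea _ Ec _ Ex _; rewrite /= Ea Ec Ex.
- by apply: (nent true false false true false true) => // v Ea _ _ Ed Ex _; rewrite /= Ea Ed Ex.
- by apply: (nent false true true false false true) => // v _ Eb Ec _ Ex _; rewrite /= Eb Ec Ex.
- by apply: (nent false true false true false true) => // v _ Eb _ Ed Ex _; rewrite /= Eb Ed Ex.
Qed.
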